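(* Let $A\in\mathbb{R}^{n\times n}$ be nonsingular, let $u,v,b\in\mathbb{R}^n$, and let $\hat x$ be the solution of $(A+uv^T)x=b$ computed by the Sherman–Morrison formula from computed solutions $\hat y$ of $Ay=b$ and $\hat z$ of $Az=u$, where these systems are solved with a normwise backward stable algorithm, i.e. $$(A+\Delta_1)\hat y=b,\quad \|\Delta_1\|\le c_1\epsilon_M\|A\|,\qquad (A+\Delta_2)\hat z=u,\quad \|\Delta_2\|\le c_2\epsilon_M\|A\|,$$ with $c_1,c_2$ modest multiples of $1$. Assume that the rounding errors in $\alpha=v^T\hat y$, in $\beta=1+v^T\hat z$, in their division and in the multiplication with the entries of $\hat z$ are insignificant, so that $\hat x=(\hat y-\frac{\alpha}{\beta}\hat z)+\delta\hat x$ with $|\delta\hat x|\le\epsilon_M|\hat y-\frac{\alpha}{\beta}\hat z|$ entrywise. Assume $|v^T\hat z|>1.1$ and $c_1\epsilon_M\kappa(A)<1$. Then the residual $r=b-(A+uv^T)\hat x$ satisfies $$\|r\|\le \epsilon_M\,\frac{\check c}{1-c_1\epsilon_M\kappa(A)}\Big(c\,\|A\|+\|A+uv^T\|\Big)\|A^{-1}\|\,\|b\|+\mathcal{O}(\epsilon_M^2),$$ where $c=\max\{c_1,c_2\}$ and $$\check c=1+\frac{1}{1-|\zeta|}\,\frac{|\cos\theta_{v,\hat y}|}{|\cos\theta_{v,\hat z}|},\qquad \zeta=(v^T\hat z)^{-1}.$$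
   Context: $\epsilon_M$ is the unit roundoff. $\|\cdot\|$ is the Euclidean vector norm and the induced spectral matrix norm; $\kappa(A)=\|A\|\,\|A^{-1}\|$. $|w|$ denotes the entrywise absolute value of a vector $w$. $\theta_{v,\hat y}$ and $\theta_{v,\hat z}$ are the angles between $v$ and $\hat y$, and between $v$ and $\hat z$ (with $\cos\theta_{v,\hat y}:=0$ if $\hat y=0$). The Sherman–Morrison formula for $(A+uv^T)x=b$ is: solve $Ay=b$, solve $Az=u$, set $\alpha=v^Ty$, $\beta=1+v^Tz$, and output $x=y-\frac{\alpha}{\beta}z$. ''The rounding errors are insignificant'' means that $\alpha$, $\beta$ and $\frac{\alpha}{\beta}\hat z$ are treated as exactly evaluated from $\hat y,\hat z$; the only rounding errors are those in the two linear solves and in the final subtraction. $\mathcal{O}(\epsilon_M^2)$ denotes terms of second order in $\epsilon_M$ as $\epsilon_M\to0$. *)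

(* Defs.v *)
From mathcomp Require Import all_boot all_order all_algebra.
From mathcomp Require Import all_classical all_reals all_analysis.
Set Implicit Arguments.
Unset Strict Implicit.
Unset Printing Implicit Defensive.
Import Order.TTheory GRing.Theory Num.Theory.
Import numFieldNormedType.Exports.
Local Open Scope classical_set_scope.
Local Open Scope ring_scope.

Definition dotv (R : realType) (n : nat) (x y : 'cV[R]_n) : R := (x^T *m y) 0 0.

(* MathComp-Analysis equips matrices with the entrywise maximum norm, so the
   Euclidean and spectral norms have to be introduced separately. *)
Definition norm2 (R : realType) (n : nat) (x : 'cV[R]_n) : R :=
  Num.sqrt (\sum_i x i 0 ^+ 2).

(* The unit ball rather than the unit sphere, so that the set is nonempty also
   when n = 0. *)
Definition mxnorm2 (R : realType) (n : nat) (A : 'M[R]_n) : R :=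
  sup [set norm2 (A *m x) | x in [set x : 'cV[R]_n | norm2 x <= 1]].

Definition cond2 (R : realType) (n : nat) (A : 'M[R]_n) : R :=
  mxnorm2 A * mxnorm2 (invmx A).

(* If x or y is zero the quotient is 0 because 0^-1 = 0, hence the angle is
   pi / 2 and its cosine is 0. *)
Definition angle (R : realType) (n : nat) (x y : 'cV[R]_n) : R :=
  acos (dotv x y / (norm2 x * norm2 y)).

(* Main.v *)
(* Write w = yh - (alpha / beta) zh.  The parts of (A + u v^T) w along u cancel,
   which leaves r = D1 yh - (alpha / beta) D2 zh - (A + u v^T) dxh.  Expressing
   alpha and beta through the angles gives
   |alpha / beta| ||zh|| <= (cc - 1) ||yh||, hence ||w|| <= cc ||yh||, and
   yh = A^-1 (b - D1 yh) gives ||yh|| <= ||A^-1|| ||b|| / (1 - c1 eps kappa(A)).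
   The bound therefore holds exactly, with second-order term zero. *)
Require Import Defs.
From mathcomp Require Import all_boot all_order all_algebra.
From mathcomp Require Import all_classical all_reals all_analysis.
From mathcomp Require Import ring lra.
Set Implicit Arguments.
Unset Strict Implicit.
Unset Printing Implicit Defensive.
Import Order.TTheory GRing.Theory Num.Theory.
Import numFieldNormedType.Exports.
Local Open Scope classical_set_scope.
Local Open Scope ring_scope.

Section EuclideanNorm.
Variables (R : realType) (n : nat).
Implicit Types (x y z : 'cV[R]_n) (A : 'M[R]_n).

Lemma dotvE x y : dotv x y = \sum_i x i 0 * y i 0.
Proof. by rewrite /dotv mxE; apply: eq_bigr => i _; rewrite mxE. Qed.

Lemma dotvC x y : dotv x y = dotv y x.
Proof. by rewrite !dotvE; apply: eq_bigr => i _; rewrite mulrC. Qed.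

Lemma dotvDr x y z : dotv x (y + z) = dotv x y + dotv x z.
Proof. by rewrite /dotv mulmxDr mxE. Qed.

Lemma dotvZr (a : R) x y : dotv x (a *: y) = a * dotv x y.
Proof. by rewrite /dotv -scalemxAr mxE. Qed.

Lemma mulmx_dotv x y z : x *m y^T *m z = dotv y z *: x.
Proof. by rewrite -mulmxA [y^T *m z]mx11_scalar mul_mx_scalar. Qed.

Lemma norm2_ge0 x : 0 <= norm2 x.
Proof. exact: sqrtr_ge0. Qed.

Lemma dotvv x : dotv x x = norm2 x ^+ 2.
Proof.
rewrite sqr_sqrtr; last by apply: sumr_ge0 => i _; exact: sqr_ge0.
by rewrite dotvE; apply: eq_bigr => i _; rewrite expr2.
Qed.

Lemma norm2_eq0 x : norm2 x = 0 -> x = 0.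
Proof.
move=> x0; have : \sum_i x i 0 ^+ 2 = 0.
  transitivity (dotv x x); last by rewrite dotvv x0 expr0n.
  by rewrite dotvE; apply: eq_bigr => i _; rewrite expr2.
move/eqP; rewrite psumr_eq0 => [/allP x2|i _]; last exact: sqr_ge0.
apply/matrixP => i j; rewrite ord1 mxE.
by apply/eqP; rewrite -sqrf_eq0; apply: (implyP (x2 i _)); rewrite ?mem_index_enum.
Qed.

(** Cauchy-Schwarz. For nonzero [y], the vector [w] is ||y||^2 times the component of [x] orthogonal
    to [y], scaled to avoid a division; its squared norm is ||y||^2 times the gap between the two
    squared sides, so that gap is nonnegative. *)
Lemma normr_dotv_le x y : `|dotv x y| <= norm2 x * norm2 y.
Proof.
have [y0|y_neq0] := eqVneq (norm2 y) 0.
  by rewrite (norm2_eq0 y0) dotvE big1 ?normr0 ?mulr_ge0 ?norm2_ge0 // => i _;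
     rewrite mxE mulr0.
have y_gt0 : 0 < norm2 y ^+ 2 by rewrite exprn_gt0 // lt0r y_neq0 norm2_ge0.
set w := norm2 y ^+ 2 *: x + (- dotv x y) *: y.
have w2 : dotv w w =
    norm2 y ^+ 2 * ((norm2 x * norm2 y) ^+ 2 - dotv x y ^+ 2).
  rewrite /w dotvDr !dotvZr ![dotv (_ + _) _]dotvC !dotvDr !dotvZr.
  by rewrite !dotvv (dotvC y x); ring.
have : 0 <= dotv w w by rewrite dotvv sqr_ge0.
rewrite w2 pmulr_rge0 // subr_ge0 => le_sqr.
by rewrite -ler_sqr ?nnegrE ?mulr_ge0 ?norm2_ge0 // real_normK // num_real.
Qed.

Lemma norm2D x y : norm2 (x + y) <= norm2 x + norm2 y.
Proof.
rewrite -ler_sqr ?nnegrE ?addr_ge0 ?norm2_ge0 //.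
rewrite -(dotvv (x + y)) dotvDr ![dotv (_ + _) _]dotvC !dotvDr !dotvv (dotvC y x).
have := le_trans (ler_norm _) (normr_dotv_le x y); lra.
Qed.

Lemma norm2Z (a : R) x : norm2 (a *: x) = `|a| * norm2 x.
Proof.
rewrite /norm2 -sqrtr_sqr -sqrtrM ?sqr_ge0 // mulr_sumr; congr Num.sqrt.
by apply: eq_bigr => i _; rewrite mxE exprMn.
Qed.

Lemma norm2N x : norm2 (- x) = norm2 x.
Proof. by rewrite -scaleN1r norm2Z normrN1 mul1r. Qed.

Lemma norm2B x y : norm2 (x - y) <= norm2 x + norm2 y.
Proof. by rewrite -(norm2N y) norm2D. Qed.

Lemma norm2_le_entrywise (a : R) x y : 0 <= a ->
  (forall i, `|x i 0| <= a * `|y i 0|) -> norm2 x <= a * norm2 y.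
Proof.
move=> a0 le_xy; rewrite -(ger0_norm a0) -norm2Z /norm2.
apply: ler_wsqrtr; apply: ler_sum => i _.
rewrite mxE -[leLHS]real_normK ?num_real // -[leRHS]real_normK ?num_real //.
by rewrite ler_sqr ?nnegrE ?normr_ge0 // normrM (ger0_norm a0).
Qed.

(** Cauchy-Schwarz applied to each row of [A]. The Frobenius norm is used only as some finite bound,
    which makes the supremum in [mxnorm2] a genuine one. *)
Lemma norm2_mulmx_frobenius A x :
  norm2 (A *m x) <= Num.sqrt (\sum_i norm2 (row i A)^T ^+ 2) * norm2 x.
Proof.
rewrite -ler_sqr ?nnegrE ?mulr_ge0 ?sqrtr_ge0 ?norm2_ge0 // exprMn.
rewrite -(dotvv (A *m x)) sqr_sqrtr; last first.
  by apply: sumr_ge0 => i _; exact: sqr_ge0.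
rewrite dotvE mulr_suml; apply: ler_sum => i _.
have -> : (A *m x) i 0 = dotv (row i A)^T x.
  by rewrite dotvE mxE; apply: eq_bigr => j _; rewrite !mxE.
rewrite -expr2 -exprMn -real_normK ?num_real // ler_sqr ?nnegrE ?normr_ge0 //.
  exact: normr_dotv_le.
by rewrite mulr_ge0 ?norm2_ge0.
Qed.

Lemma has_ubound_mxnorm2 A :
  has_ubound [set norm2 (A *m x) | x in [set x : 'cV[R]_n | norm2 x <= 1]].
Proof.
exists (Num.sqrt (\sum_i norm2 (row i A)^T ^+ 2)) => _ [x /= x1 <-].
by rewrite (le_trans (norm2_mulmx_frobenius A x)) // ler_piMr ?sqrtr_ge0.
Qed.

Lemma norm2_0 : norm2 (0 : 'cV[R]_n) = 0.
Proof. by rewrite -(scale0r 0) norm2Z normr0 mul0r. Qed.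

Lemma mxnorm2_ge0 A : 0 <= mxnorm2 A.
Proof.
apply: (ub_le_sup (has_ubound_mxnorm2 A)).
by exists 0; rewrite /= ?mulmx0 norm2_0 ?ler01.
Qed.

Lemma norm2_mulmx A x : norm2 (A *m x) <= mxnorm2 A * norm2 x.
Proof.
have [x0|x_neq0] := eqVneq (norm2 x) 0.
  by rewrite (norm2_eq0 x0) mulmx0 norm2_0 mulr0.
have x_gt0 : 0 < norm2 x by rewrite lt0r x_neq0 norm2_ge0.
rewrite -ler_pdivrMr //; apply: (ub_le_sup (has_ubound_mxnorm2 A)).
(* Normalizing [x] gives a point of the unit ball. *)
exists ((norm2 x)^-1 *: x);
  rewrite /= -?scalemxAr norm2Z ger0_norm ?invr_ge0 ?norm2_ge0 //.
  by rewrite mulVf.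
by rewrite mulrC.
Qed.

Lemma cos_angle x y : cos (angle x y) = dotv x y / (norm2 x * norm2 y).
Proof.
(* [acos] inverts [cos] on [-1, 1], and Cauchy-Schwarz puts the quotient there; for a zero vector
   the quotient is 0. *)
rewrite /angle acosK // in_itv /= -ler_norml.
have xy_ge0 : 0 <= norm2 x * norm2 y by rewrite mulr_ge0 ?norm2_ge0.
rewrite normrM normfV (ger0_norm xy_ge0).
have [->|xy_neq0] := eqVneq (norm2 x * norm2 y) 0; first by rewrite invr0 mulr0.
by rewrite ler_pdivrMr ?lt0r ?xy_neq0 // mul1r normr_dotv_le.
Qed.

(** If a norm vanishes, both sides are 0 by Cauchy-Schwarz; otherwise this is the formula for the
    cosine, cleared of its denominator. *)
Lemma normr_dotv_cos x y :
  `|dotv x y| = norm2 x * norm2 y * `|cos (angle x y)|.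
Proof.
have xy_ge0 : 0 <= norm2 x * norm2 y by rewrite mulr_ge0 ?norm2_ge0.
have [xy0|xy_neq0] := eqVneq (norm2 x * norm2 y) 0.
  rewrite xy0 mul0r; apply/eqP; rewrite -normr_le0 normr_id -xy0.
  exact: normr_dotv_le.
by rewrite cos_angle normrM normfV (ger0_norm xy_ge0) mulrCA mulfV // mulr1.
Qed.

(** From y = A^-1 (b - D y) follows ||y|| <= ||A^-1|| (||b|| + d ||y||); the term in ||y|| on the
    right is absorbed into the left side, since d ||A^-1|| < 1. *)
Lemma norm2_perturbed_solution A D y b (d : R) :
  A \in unitmx -> (A + D) *m y = b -> mxnorm2 D <= d ->
  d * mxnorm2 (invmx A) < 1 ->
  norm2 y <= mxnorm2 (invmx A) * norm2 b / (1 - d * mxnorm2 (invmx A)).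
Proof.
move=> hA hy hD hd; rewrite ler_pdivlMr ?subr_gt0 //.
have yE : y = invmx A *m (b - D *m y) by rewrite -hy mulmxDl addrK mulKmx.
have hDy : norm2 (D *m y) <= d * norm2 y.
  by apply: le_trans (norm2_mulmx D y) _; rewrite ler_wpM2r ?norm2_ge0.
have : norm2 y <= mxnorm2 (invmx A) * (norm2 b + d * norm2 y).
  rewrite {1}yE; apply: le_trans (norm2_mulmx _ _) _.
  apply: ler_wpM2l; first exact: mxnorm2_ge0.
  by apply: le_trans (norm2B _ _) _; rewrite lerD2l.
lra.
Qed.

(** The denominator satisfies |1 + v^T z| >= |v^T z| (1 - |zeta|). Writing v^T y and v^T z through
    cosines, ||v|| and ||z|| cancel and the ratio of cosines remains. *)
Lemma norm2_correction_le (v y z : 'cV[R]_n) : 1 < `|dotv v z| ->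
  norm2 ((dotv v y / (1 + dotv v z)) *: z) <=
  (1 - `|(dotv v z)^-1|)^-1
    * (`|cos (angle v y)| / `|cos (angle v z)|) * norm2 y.
Proof.
move=> vz_gt1.
have vz_gt0 : 0 < `|dotv v z| by apply: lt_trans vz_gt1.
have zeta_lt1 : 0 < 1 - `|(dotv v z)^-1|.
  by rewrite normfV subr_gt0 invf_lt1.
(* The left side equals |v^T z| - 1, so this is the reverse triangle inequality. *)
have beta_ge : `|dotv v z| * (1 - `|(dotv v z)^-1|) <= `|1 + dotv v z|.
  rewrite normfV mulrBr mulr1 mulfV ?gt_eqF //.
  by rewrite [1 + _]addrC -[X in _ - X](normr1 R) lerB_normD.
have := normr_dotv_cos v z; have := normr_dotv_cos v y.
have : 0 < norm2 v * norm2 z by apply: lt_le_trans (normr_dotv_le v z).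
rewrite norm2Z normrM normfV.
move=> vz_n /[dup] Ey -> Ez.
have cz : 0 < `|cos (angle v z)| by move: vz_gt0; rewrite Ez pmulr_rgt0.
have v0 : norm2 v != 0 by apply: contraTneq vz_n => ->; rewrite mul0r ltxx.
have z0 : norm2 z != 0 by apply: contraTneq vz_n => ->; rewrite mulr0 ltxx.
(* Both sides now share the factor ||z|| and the numerator |v^T y|, so only the denominators need
   comparing. *)
have -> : (1 - `|(dotv v z)^-1|)^-1
    * (`|cos (angle v y)| / `|cos (angle v z)|) * norm2 y =
  norm2 v * norm2 y * `|cos (angle v y)|
    / (`|dotv v z| * (1 - `|(dotv v z)^-1|)) * norm2 z.
  rewrite Ez; field.
  by rewrite v0 z0 (gt_eqF zeta_lt1) (gt_eqF cz).
apply: ler_wpM2r; first exact: norm2_ge0.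
apply: ler_wpM2l; first by rewrite -Ey.
by rewrite lef_pV2 // posrE ?mulr_gt0 // (lt_le_trans _ beta_ge) ?mulr_gt0.
Qed.

End EuclideanNorm.

(** After substituting A y = b - D1 y and A z = u - D2 z, the coefficient of [u] is v^T y - a (1 +
    v^T z), which is 0 by the choice of [a]. *)
Lemma sherman_morrison_residual (R : realType) (n : nat) (A D1 D2 : 'M[R]_n)
    (u v b y z : 'cV[R]_n) :
  (A + D1) *m y = b -> (A + D2) *m z = u -> 1 + dotv v z != 0 ->
  let a := dotv v y / (1 + dotv v z) in
  b - (A + u *m v^T) *m (y - a *: z) = D1 *m y - D2 *m (a *: z).
Proof.
move=> hy hz b0 a.
have Ay : A *m y = b - D1 *m y by rewrite -hy mulmxDl addrK.
have Az : A *m z = u - D2 *m z by rewrite -hz mulmxDl addrK.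
have aE : a * (1 + dotv v z) = dotv v y by rewrite /a mulfVK.
rewrite mulmxBr !mulmxDl -!scalemxAr !mulmx_dotv Ay Az -aE.
apply/matrixP => i j; rewrite !mxE; ring.
Qed.

Theorem proposition3p2 (R : realType) (n : nat) (A : 'M[R]_n)
    (u v b : 'cV[R]_n) (c1 c2 : R) (hA : A \in unitmx) :
  exists rho : R -> R,
    rho =O_ (0^'+) (fun e => e ^+ 2) /\
    forall (eps : R) (D1 D2 : 'M[R]_n) (yh zh dxh xh : 'cV[R]_n),
      let alpha := dotv v yh in
      let beta := 1 + dotv v zh in
      let zeta := (dotv v zh)^-1 in
      let c := Num.max c1 c2 in
      let cc := 1 + (1 - `|zeta|)^-1
                    * (`|cos (angle v yh)| / `|cos (angle v zh)|) in
      let r := b - (A + u *m v^T) *m xh in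
      0 < eps ->
      (A + D1) *m yh = b -> mxnorm2 D1 <= c1 * eps * mxnorm2 A ->
      (A + D2) *m zh = u -> mxnorm2 D2 <= c2 * eps * mxnorm2 A ->
      xh = (yh - (alpha / beta) *: zh) + dxh ->
      (forall i, `|dxh i 0| <= eps * `|(yh - (alpha / beta) *: zh) i 0|) ->
      11 / 10 < `|dotv v zh| ->
      c1 * eps * cond2 A < 1 ->
      norm2 r <= eps * (cc / (1 - c1 * eps * cond2 A))
                 * (c * mxnorm2 A + mxnorm2 (A + u *m v^T))
                 * mxnorm2 (invmx A) * norm2 b + rho eps.
Proof.
exists (fun=> 0); split.
  apply/eqO_exP; exists 1 => //; apply: filterE => x.
  by rewrite normr0 mul1r.
move=> eps D1 D2 yh zh dxh xh alpha beta zeta c cc r.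
move=> eps0 hy hD1 hz hD2 hx hdx hv hk; rewrite addr0.
have vz_gt1 : 1 < `|dotv v zh| by lra.
have beta0 : beta != 0.
  apply: contraTneq vz_gt1; rewrite /beta addrC => /eqP.
  by rewrite addr_eq0 => /eqP ->; rewrite normrN1 ltxx.
set w := yh - (alpha / beta) *: zh in hx hdx.
set q := (alpha / beta) *: zh in w hx hdx.
have rE : r = D1 *m yh - D2 *m q - (A + u *m v^T) *m dxh.
  by rewrite -(sherman_morrison_residual hy hz beta0) /r hx mulmxDr opprD addrA.
have hq : norm2 q <= (cc - 1) * norm2 yh.
  by rewrite /cc addrC addKr; apply: norm2_correction_le.
have hw : norm2 w <= cc * norm2 yh.
  by have := norm2B yh q; rewrite -/w; lra.
have ndx := norm2_le_entrywise (ltW eps0) hdx.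
have hk' : c1 * eps * mxnorm2 A * mxnorm2 (invmx A) < 1.
  by move: hk; rewrite /cond2 mulrA.
(* Here d = c1 eps ||A||, so d ||A^-1|| is c1 eps kappa(A). *)
have hyn := norm2_perturbed_solution hA hy hD1 hk'.
set K := c * mxnorm2 A + mxnorm2 (A + u *m v^T).
(* Brings both backward errors to the common constant [c], so that their contributions can be
   added. *)
have Ac (d : R) D x : mxnorm2 D <= d * eps * mxnorm2 A -> d <= c ->
    norm2 (D *m x) <= eps * c * mxnorm2 A * norm2 x.
  move=> hD dc; apply: le_trans (norm2_mulmx D x) _.
  apply: ler_wpM2r; first exact: norm2_ge0.
  apply: le_trans hD _; apply: ler_wpM2r; first exact: mxnorm2_ge0.
  by rewrite mulrC ler_pM2l.
have c1_le : c1 <= c by rewrite le_max lexx.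
have c2_le : c2 <= c by rewrite le_max lexx orbT.
(* The sign is read off from 0 <= ||D1|| <= c1 eps ||A|| <= c eps ||A||. *)
have cA_ge0 : 0 <= eps * c * mxnorm2 A.
  apply: le_trans (mxnorm2_ge0 D1) (le_trans hD1 _).
  by rewrite ler_wpM2r ?mxnorm2_ge0 // mulrC ler_pM2l.
have K_ge0 : 0 <= K.
  by rewrite addr_ge0 ?mxnorm2_ge0 // -(pmulr_rge0 _ eps0) mulrA.
have zeta_lt1 : 0 < 1 - `|zeta|.
  by rewrite normfV subr_gt0 invf_lt1 // (lt_trans ltr01).
have cc_ge0 : 0 <= cc.
  by rewrite addr_ge0 // mulr_ge0 ?divr_ge0 // invr_ge0 ltW.
have r_le : norm2 r <= eps * cc * K * norm2 yh.
  (* The three summands bound D1 yh, D2 q and (A + u v^T) dxh in turn; the first two combine through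
     1 + (cc - 1) = cc. *)
  have -> : eps * cc * K * norm2 yh = eps * c * mxnorm2 A * norm2 yh
      + eps * c * mxnorm2 A * ((cc - 1) * norm2 yh)
      + mxnorm2 (A + u *m v^T) * (eps * (cc * norm2 yh)) by rewrite /K; ring.
  rewrite rE; apply: le_trans (norm2B _ _) _; apply: lerD.
    apply: le_trans (norm2B _ _) _.
    apply: lerD; first exact: Ac hD1 c1_le.
    by apply: le_trans (Ac _ _ _ q hD2 c2_le) _; exact: ler_wpM2l cA_ge0 _ _ hq.
  apply: le_trans (norm2_mulmx _ _) _.
  apply: ler_wpM2l; first exact: mxnorm2_ge0.
  by apply: le_trans ndx _; exact: ler_wpM2l (ltW eps0) _ _ hw.
apply: le_trans r_le _.
have -> : eps * (cc / (1 - c1 * eps * cond2 A)) * K * mxnorm2 (invmx A) * norm2 b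
  = eps * cc * K * (mxnorm2 (invmx A) * norm2 b / (1 - c1 * eps * cond2 A)) by ring.
apply: ler_wpM2l; first by rewrite !mulr_ge0 // ltW.
by rewrite /cond2 mulrA.
Qed.
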